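(* Let $(U,\varphi)$ be a finite standard closure space whose lattice of closed sets $(\mathcal{C},\subseteq)$ is semidistributive. Then the aggregated $E$-base of $(U,\varphi)$ is valid, and it is minimum, i.e. no set of implications $\Sigma$ with $\Sigma(X)=\varphi(X)$ for all $X\subseteq U$ has fewer implications than the aggregated $E$-base.
   Context: A closure space $(U,\varphi)$ is a finite set $U$ with a closure operator $\varphi$ on $2^U$ (extensive, monotone, idempotent). Its closed sets $\mathcal{C}=\{C:\varphi(C)=C\}$ form a lattice under inclusion with meet $\cap$ and join $C_1\vee C_2=\varphi(C_1\cup C_2)$. The space is standard if $\varphi(\{x\})\setminus\{x\}$ is closed for every $x\in U$. A lattice is semidistributive if it is both join-semidistributive ($a\vee b=a\vee c$ implies $a\vee b=a\vee(b\wedge c)$) and meet-semidistributive (the dual). The binary part is $\varphi^b(X)=\bigcup_{x\in X}\varphi(\{x\})$. For $x\in U$, a $D$-generator of $x$ is a set $A\subseteq U$ with $x\in\varphi(A)$, $x\notin\varphi^b(A)$, and $x\notin\varphi(B)$ for every $B\subseteq U$ with $\varphi^b(B)\subsetneq\varphi^b(A)$. An $E$-generator of $x$ is a $D$-generator $A$ of $x$ such that $\varphi(A)$ is inclusion-minimal in $\{\varphi(B): B \text{ a } D\text{-generator of } x\}$. An implication is a pair $A\to X$ of subsets of $U$; a set $\Sigma$ of implications induces the closure operator $\Sigma(\cdot)$ whose closed sets are the $C\subseteq U$ such that $A\subseteq C$ implies $X\subseteq C$ for all $A\to X\in\Sigma$. The $E$-base is $\Sigma_E=\{a\to x: a,x\in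 U, x\neq a, x\in\varphi(\{a\})\}\cup\{A\to x: x\in U, A \text{ an } E\text{-generator of } x\}$; its aggregated form replaces all implications with the same premise $A$ by the single implication $A\to$ (union of their conclusions). It is valid if the induced closure operator equals $\varphi$.
   Formalization: A D-generator A of x is additionally required to be inclusion-minimal (x not in φ(B) for every B strictly inside A); without this the minimum claim fails, e.g. closed sets ∅, y, yz, yzx, b, yb, yzxb, where zb and yzb would both be E-generators of x. *)

(* Defs.v *)
From mathcomp Require Import all_boot.
Set Implicit Arguments.
Unset Strict Implicit.
Unset Printing Implicit Defensive.

Definition closure_operator (U : finType) (phi : {set U} -> {set U}) : Prop :=
  [/\ forall X : {set U}, X \subset phi X,
      forall X Y : {set U}, X \subset Y -> phi X \subset phi Y
    & forall X : {set U}, phi (phi X) = phi X].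

Definition is_closed (U : finType) (phi : {set U} -> {set U}) (C : {set U}) :
  bool := phi C == C.

Definition standard (U : finType) (phi : {set U} -> {set U}) : Prop :=
  forall x : U, is_closed phi (phi [set x] :\ x).

Definition cjoin (U : finType) (phi : {set U} -> {set U})
  (C1 C2 : {set U}) : {set U} := phi (C1 :|: C2).

Definition join_semidistributive (U : finType) (phi : {set U} -> {set U}) :
  Prop :=
  forall A B C : {set U}, is_closed phi A -> is_closed phi B -> is_closed phi C ->
    cjoin phi A B = cjoin phi A C -> cjoin phi A B = cjoin phi A (B :&: C).

Definition meet_semidistributive (U : finType) (phi : {set U} -> {set U}) :
  Prop :=
  forall A B C : {set U}, is_closed phi A -> is_closed phi B -> is_closed phi C ->
    A :&: B = A :&: C -> A :&: B = A :&: cjoin phi B C.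

Definition semidistributive (U : finType) (phi : {set U} -> {set U}) : Prop :=
  join_semidistributive phi /\ meet_semidistributive phi.

Definition binary_part (U : finType) (phi : {set U} -> {set U})
  (X : {set U}) : {set U} := \bigcup_(x in X) phi [set x].

(* The last clause says that A is a minimal generator of x. It is not implied
   by the previous one: if y lies in binary_part phi A but not in A, then A and
   y |: A have the same binary part, so without it both would qualify and the
   E-base would contain redundant premises. *)
Definition D_generator (U : finType) (phi : {set U} -> {set U})
  (x : U) (A : {set U}) : bool :=
  [&& x \in phi A,
      x \notin binary_part phi A,
      [forall B : {set U},
        (binary_part phi B \proper binary_part phi A) ==> (x \notin phi B)]
    & [forall B : {set U}, (B \proper A) ==> (x \notin phi B)]].

Definition E_generator (U : finType) (phi : {set U} -> {set U})
  (x : U) (A : {set U}) : bool :=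
  D_generator phi x A &&
  [forall B : {set U}, D_generator phi x B ==> ~~ (phi B \proper phi A)].

Definition implication (U : finType) : finType := ({set U} * {set U})%type.

Definition models (U : finType) (Sigma : {set implication U})
  (C : {set U}) : bool :=
  [forall i in Sigma, (i.1 \subset C) ==> (i.2 \subset C)].

Definition induced_closure (U : finType) (Sigma : {set implication U})
  (X : {set U}) : {set U} :=
  \bigcap_(C : {set U} | models Sigma C && (X \subset C)) C.

Definition valid (U : finType) (phi : {set U} -> {set U})
  (Sigma : {set implication U}) : Prop :=
  forall X : {set U}, induced_closure Sigma X = phi X.

Definition E_base (U : finType) (phi : {set U} -> {set U}) :
  {set implication U} :=
  [set ([set a], [set x]) | a in [set: U], x in phi [set a] :\ a]
  :|: [set (A, [set x]) | x in [set: U], A in [set A | E_generator phi x A]].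

Definition aggregate (U : finType) (Sigma : {set implication U}) :
  {set implication U} :=
  [set (A, \bigcup_(i in Sigma | i.1 == A) i.2) | A in [set i.1 | i in Sigma]].

(* Main.v *)
(** Validity.  Let [Q] be a model of the E-base which is not closed, with
    [C = phi Q] of least size.  Then [Q :&: K] is closed for every closed
    [K] strictly below [C], and meet-semidistributivity forces [Q] to contain
    the intersection of any two distinct lower covers of [C].  Let [C1] be a
    lower cover of [C] not included in [Q], [H] a lower cover of [C1] above
    [Q :&: C1], and [x] a least element of [C1 :\: H], which exists by
    join-semidistributivity.  Every D-generator of [x] that generates less than
    [C] would lie in [C1] but not in [H], hence would have an element above [x].
    So a D-generator of [x] inside [Q] is an E-generator, and [x] is in [Q].

    Minimality.  Join-semidistributivity makes an E-generator recoverable from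
    its closure, so distinct premises have distinct closures.  If [A] is an
    E-generator of [x], the elements of [phi A] that are not above [x] form a
    quasi-closed set generating [phi A]; thus every valid set of implications
    has a premise with the same closure as [A]. *)

Require Import Defs.
From mathcomp Require Import all_boot.

Set Implicit Arguments.
Unset Strict Implicit.
Unset Printing Implicit Defensive.

(** * Models of a set of implications and the closure it induces *)

Lemma models_sub_induced_closure (U : finType) (Sigma : {set implication U})
    (X C : {set U}) :
  models Sigma C -> X \subset C -> induced_closure Sigma X \subset C.
Proof. by move=> mC XC; apply: bigcap_inf; rewrite mC. Qed.

Lemma modelsP (U : finType) (Sigma : {set implication U}) (C : {set U}) :
  reflect (forall i, i \in Sigma -> i.1 \subset C -> i.2 \subset C)
          (models Sigma C).
Proof.
apply: (iffP forall_inP) => [mC i iS | mC i iS]; first exact/implyP/mC.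
exact/implyP/mC.
Qed.

Lemma models_aggregate (U : finType) (Sigma : {set implication U})
    (C : {set U}) :
  models (aggregate Sigma) C = models Sigma C.
Proof.
apply/modelsP/modelsP => [mC i iS iC | mC i /imsetP[A _ ->] /= AC].
  have /mC/(_ iC)/= : (i.1, \bigcup_(j in Sigma | j.1 == i.1) j.2)
      \in aggregate Sigma by apply/imsetP; exists i.1 => //; apply: imset_f.
  by apply: subset_trans; apply: (bigcup_sup i); rewrite iS /=.
apply/bigcupsP => j /andP[jS /eqP jA].
by apply: mC => //; rewrite jA.
Qed.

Lemma valid_models (U : finType) (phi : {set U} -> {set U})
    (Sigma : {set implication U}) :
  closure_operator phi -> (forall C, models Sigma C = is_closed phi C) ->
  valid phi Sigma.
Proof.
move=> [ext mono idem] mE X; apply/eqP; rewrite eqEsubset; apply/andP; split.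
  apply: models_sub_induced_closure; last exact: ext.
  by rewrite mE /is_closed idem.
apply/bigcapsP => C /andP[]; rewrite mE => /eqP cC XC.
by rewrite -cC mono.
Qed.

Lemma valid_conclusion (U : finType) (phi : {set U} -> {set U})
    (Sigma : {set implication U}) (i : implication U) :
  valid phi Sigma -> i \in Sigma -> i.2 \subset phi i.1.
Proof.
move=> vS iS; rewrite -vS; apply/bigcapsP => C /andP[/modelsP mC]; exact: mC.
Qed.

(** * Closures, binary parts and generators *)

Section ClosureSpace.

Variables (U : finType) (phi : {set U} -> {set U}).
Hypothesis phi_closure : closure_operator phi.

Local Notation bin := (binary_part phi).
Local Notation closed := (is_closed phi).

Lemma sub_closure (X : {set U}) : X \subset phi X.
Proof. by have [] := phi_closure. Qed.

Lemma closureS (X Y : {set U}) : X \subset Y -> phi X \subset phi Y.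
Proof. by have [_ + _] := phi_closure; apply. Qed.

Lemma closureK X : phi (phi X) = phi X.
Proof. by have [] := phi_closure. Qed.

Lemma closed_closure X : closed (phi X).
Proof. by rewrite /is_closed closureK. Qed.

Lemma closure_sub (X C : {set U}) :
  closed C -> (phi X \subset C) = (X \subset C).
Proof.
move=> /eqP cC; apply/idP/idP; first exact/subset_trans/sub_closure.
by rewrite -{2}cC; apply: closureS.
Qed.

Lemma closure1_sub x (C : {set U}) : closed C -> (phi [set x] \subset C) = (x \in C).
Proof. by move=> cC; rewrite closure_sub // sub1set. Qed.

Lemma mem_closure1 x : x \in phi [set x].
Proof. by rewrite -sub1set sub_closure. Qed.

Lemma closedI (C D : {set U}) : closed C -> closed D -> closed (C :&: D).
Proof.
move=> cC cD; rewrite /is_closed eqEsubset sub_closure andbT subsetI.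
by rewrite !closure_sub ?subsetIl ?subsetIr.
Qed.

Lemma closureUS (X Y C : {set U}) :
  closed C -> X \subset C -> Y \subset C -> cjoin phi X Y \subset C.
Proof. by move=> cC XC YC; rewrite closure_sub // subUset XC. Qed.

Lemma mem_binary_part x (X : {set U}) :
  reflect (exists2 y, y \in X & x \in phi [set y]) (x \in bin X).
Proof. exact: bigcupP. Qed.

Lemma sub_binary_part (X : {set U}) : X \subset bin X.
Proof.
by apply/subsetP => x xX; apply/mem_binary_part; exists x; rewrite ?mem_closure1.
Qed.

Lemma binary_part_sub_closure X : bin X \subset phi X.
Proof.
by apply/bigcupsP => x xX; apply: closureS; rewrite sub1set.
Qed.

Lemma binary_partS (X Y : {set U}) : X \subset Y -> bin X \subset bin Y.
Proof.
move=> XY; apply/subsetP => x /mem_binary_part[y yX xy].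
by apply/mem_binary_part; exists y => //; apply: (subsetP XY).
Qed.

Lemma binary_partK X : bin (bin X) = bin X.
Proof.
apply/eqP; rewrite eqEsubset sub_binary_part andbT.
apply/bigcupsP => y /mem_binary_part[z zX yz].
apply: (@subset_trans _ _ (phi [set z])).
  by rewrite closure1_sub ?closed_closure.
exact: bigcup_sup.
Qed.

Lemma closure_binary_part X : phi (bin X) = phi X.
Proof.
apply/eqP; rewrite eqEsubset closure_sub ?closed_closure //.
by rewrite binary_part_sub_closure closureS ?sub_binary_part.
Qed.

Lemma D_generatorP x (A : {set U}) :
  reflect [/\ x \in phi A, x \notin bin A,
    forall B : {set U}, bin B \proper bin A -> x \notin phi B
    & forall B : {set U}, B \proper A -> x \notin phi B]
  (D_generator phi x A).
Proof.
apply: (iffP and4P) => -[-> ->] hD hm; split=> //.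
- by move=> B; move/forallP/(_ B)/implyP: hD.
- by move=> B; move/forallP/(_ B)/implyP: hm.
- by apply/forallP => B; apply/implyP/hD.
- by apply/forallP => B; apply/implyP/hm.
Qed.

Lemma E_generatorP x (A : {set U}) :
  reflect (D_generator phi x A /\
    forall B, D_generator phi x B -> ~~ (phi B \proper phi A))
  (E_generator phi x A).
Proof.
apply: (iffP andP) => -[-> hE]; split=> //.
  by move=> B; move/forallP/(_ B)/implyP: hE.
by apply/forallP => B; apply/implyP/hE.
Qed.

(** Two successive minimisations: first the size of the binary part, then the size of the set among
    those with the binary part just found. They yield the two minimality clauses of
    [D_generator]. *)
Lemma D_generator_refine x (X : {set U}) :
  x \in phi X -> x \notin bin X ->
  exists2 A, D_generator phi x A & bin A \subset bin X.
Proof.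
move=> xX xnX.
pose P (A : {set U}) := (x \in phi A) && (bin A \subset bin X).
have P0 : P X by rewrite /P xX subxx.
case: (arg_minnP (fun A => #|bin A|) P0) => A1 /andP[xA1 A1X] min1.
pose P' (A : {set U}) := (x \in phi A) && (bin A == bin A1).
have P'0 : P' A1 by rewrite /P' xA1 eqxx.
case: (arg_minnP (fun A : {set U} => #|A|) P'0) => A /andP[xA /eqP AA1] min2.
exists A; last by rewrite AA1.
apply/D_generatorP; split=> //.
- by rewrite AA1; apply: contra xnX; apply: subsetP.
- rewrite AA1 => B BA; apply/negP => xB.
  have := min1 B; rewrite /P xB (subset_trans (proper_sub BA)) //.
  by rewrite leqNgt proper_card // => /(_ isT).
- move=> B BA; apply/negP => xB.
  (* A smaller generator [B] of [x] cannot have a smaller binary part than [A1], so it has the same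
     one and competes with [A] in the second minimisation. *)
  have BA1 : bin B \subset bin A1 by rewrite -AA1 binary_partS ?proper_sub.
  have : P B by rewrite /P xB (subset_trans BA1).
  move=> /min1 le1.
  have := min2 B; rewrite /P' xB eqEcard BA1 le1 => /(_ isT).
  by rewrite leqNgt proper_card.
Qed.

(** * Lower covers and join-semidistributivity *)

Definition lower_cover (C K : {set U}) : Prop :=
  [/\ closed K, K \proper C
    & forall D, closed D -> K \subset D -> D \subset C -> D != K -> D = C].

Lemma lower_cover_above (C X : {set U}) :
  closed X -> X \proper C -> exists2 K, lower_cover C K & X \subset K.
Proof.
move=> cX XC.
pose P (K : {set U}) := [&& closed K, X \subset K & K \proper C].
have P0 : P X by rewrite /P cX subxx.
case: (arg_maxnP (fun K : {set U} => #|K|) P0) => K /and3P[cK XK KC] maxK.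
exists K => //; split=> // D cD KD DC DK; apply/eqP; apply: contraT => nDC.
have := maxK D; rewrite /P cD (subset_trans XK) //= properEneq nDC DC.
move=> /(_ isT) leDK; case/eqP: DK; apply/eqP.
by rewrite eq_sym eqEcard KD.
Qed.

Lemma lower_cover_join (C K X : {set U}) :
  closed C -> lower_cover C K -> X \subset C -> ~~ (X \subset K) ->
  cjoin phi K X = C.
Proof.
move=> cC [cK KC cov] XC XK; apply: cov.
- exact: closed_closure.
- exact: subset_trans (subsetUl _ _) (sub_closure _).
- exact: closureUS (proper_sub KC) XC.
- apply: contra XK => /eqP <-.
  exact: subset_trans (subsetUr _ _) (sub_closure _).
Qed.

Lemma lower_cover_incomparable (C K L : {set U}) :
  lower_cover C K -> lower_cover C L -> K != L -> ~~ (L \subset K).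
Proof.
move=> [cK KC _] [_ _ covL] KL; apply/negP => LK.
have KeC := covL K cK LK (proper_sub KC) KL.
by rewrite KeC properxx in KC.
Qed.

(** [X] and [Y] both join with [K] to [C], hence so does [X :&: Y]. Thus the closed subsets of [C]
    that escape [K] are stable under intersection. *)
Lemma join_semidistributive_lower_cover (C K X Y : {set U}) :
  join_semidistributive phi -> closed C -> lower_cover C K ->
  closed X -> closed Y -> X \subset C -> Y \subset C ->
  ~~ (X \subset K) -> ~~ (Y \subset K) -> ~~ (X :&: Y \subset K).
Proof.
move=> JSD cC covK cX cY XC YC XK YK; have [cK KC _] := covK.
have jX := lower_cover_join cC covK XC XK.
have jY := lower_cover_join cC covK YC YK.
have := JSD K X Y cK cX cY; rewrite jX jY => /(_ erefl) jXY.
apply/negP => XYK; move: KC; rewrite properE jXY.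
by rewrite (closureUS cK (subxx K) XYK) andbF.
Qed.

Lemma least_outside_lower_cover (C K : {set U}) :
  join_semidistributive phi -> closed C -> lower_cover C K ->
  exists2 x, x \in C :\: K & forall y, y \in C :\: K -> x \in phi [set y].
Proof.
move=> JSD cC covK; have [cK KC _] := covK.
have [_ [x0 x0C x0K]] := properP KC.
pose P x := (x \notin K) && (x \in C).
have x0P : P x0 by rewrite /P x0C x0K.
case: (arg_minnP (fun x => #|phi [set x]|) x0P) => x /andP[xK xC] minx.
exists x => [|y]; rewrite inE ?xK ?xC // => /andP[yK yC].
(* A point [z] of this intersection outside [K] generates a subset of [phi [set x]]; minimality of
   [x] makes the two closures equal, so [x] lies below [z], hence below [y]. *)
have : ~~ (phi [set x] :&: phi [set y] \subset K).
  by apply: (join_semidistributive_lower_cover JSD cC covK);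
    rewrite ?closure1_sub // closed_closure.
case/subsetPn => z /setIP[zx zy] zK.
have zxS : phi [set z] \subset phi [set x] by rewrite closure1_sub ?closed_closure.
have zC : z \in C by apply: (subsetP _ z zx); rewrite closure1_sub.
have le : #|phi [set x]| <= #|phi [set z]| by apply: minx; rewrite /P zK zC.
have /eqP zxE : phi [set z] == phi [set x] by rewrite eqEcard zxS le.
have : x \in phi [set z] by rewrite zxE mem_closure1.
by apply: subsetP; rewrite closure1_sub ?closed_closure.
Qed.

(** Since [Q] generates more than [C2], it has a point [q] outside [C2]. Both [phi [set q]] and [C1]
    escape [C2], hence so does their intersection, which stays in [Q] because [Q] equals its binary
    part. *)
Lemma binary_closed_lower_cover (Q C1 C2 : {set U}) :
  join_semidistributive phi -> bin Q = Q ->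
  lower_cover (phi Q) C1 -> lower_cover (phi Q) C2 -> C1 != C2 ->
  ~~ (Q :&: C1 \subset C2).
Proof.
move=> JSD bQ cov1 cov2 C12; have [c1 C1C _] := cov1; have [c2 C2C _] := cov2.
have : ~~ (Q \subset C2).
  by apply/negP => QC2; move: C2C; rewrite properE closure_sub // QC2 andbF.
case/subsetPn => q qQ qC2.
have : ~~ (phi [set q] :&: C1 \subset C2).
  apply: (join_semidistributive_lower_cover JSD (closed_closure Q) cov2) => //.
  - exact: closed_closure.
  - by rewrite closureS // sub1set.
  - exact: proper_sub.
  - by rewrite closure1_sub.
  - by apply: lower_cover_incomparable cov2 cov1 _; rewrite eq_sym.
apply: contra; apply: subset_trans; apply: setSI.
by rewrite -bQ; apply: bigcup_sup.
Qed.

(** * Standard spaces and validity of the E-base *)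

Hypothesis phi_standard : standard phi.

Lemma standard_generator (X : {set U}) a :
  X \subset phi [set a] -> a \in phi X -> a \in X.
Proof.
move=> Xa aX; apply: contraT => anX.
have : phi X \subset phi [set a] :\ a.
  by rewrite closure_sub ?subsetD1 ?Xa ?anX //; apply: phi_standard.
by move/subsetP/(_ a aX); rewrite !inE eqxx.
Qed.

Lemma closure1_antisym a b : a \in phi [set b] -> b \in phi [set a] -> a = b.
Proof.
move=> ab ba; apply/eqP; rewrite -in_set1; apply: standard_generator => //.
by rewrite sub1set.
Qed.

Lemma closure0 : phi set0 = set0.
Proof.
apply/eqP; rewrite -subset0; apply/subsetP => x x0.
exact: (standard_generator (sub0set _) x0).
Qed.

(** Take a lowest point [y] of the intersection outside [Q]. Then [Q :&: C1] and [Q :&: C2] meet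
    [phi [set y]] in the same set, which misses [y], whereas their join is [phi Q] and contains [y].
    This contradicts meet-semidistributivity. *)
Lemma quasi_closed_lower_coversI (Q C1 C2 : {set U}) :
  semidistributive phi -> bin Q = Q ->
  (forall K, closed K -> K \proper phi Q -> closed (Q :&: K)) ->
  lower_cover (phi Q) C1 -> lower_cover (phi Q) C2 -> C1 != C2 ->
  C1 :&: C2 \subset Q.
Proof.
move=> [JSD MSD] bQ qQ cov1 cov2 C12.
have [c1 C1C _] := cov1; have [c2 C2C _] := cov2.
apply/subsetP => y0 y0I; apply: contraT => y0Q.
pose P y := (y \notin Q) && (y \in C1 :&: C2).
have P0 : P y0 by rewrite /P y0Q.
case: (arg_minnP (fun y => #|phi [set y]|) P0) => y /andP[yQ /setIP[y1 y2]] miny.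
have below : phi [set y] :\ y \subset Q.
  apply/subsetP => z; rewrite !inE => /andP[zy yz]; apply: contraT => zQ.
  have zS : phi [set z] \subset phi [set y] by rewrite closure1_sub ?closed_closure.
  have zI C : closed C -> y \in C -> z \in C.
    by move=> cC yC; apply: (subsetP _ z yz); rewrite closure1_sub.
  have := miny z; rewrite /P zQ inE !zI // => /(_ isT) le.
  have /eqP yzE : phi [set z] == phi [set y] by rewrite eqEcard zS le.
  case/eqP: zy; apply: closure1_antisym => //.
  by rewrite yzE mem_closure1.
have meetE K : closed K -> y \in K -> phi [set y] :&: (Q :&: K) = phi [set y] :\ y.
  move=> cK yK; apply/setP => z; rewrite !inE.
  have [->|zy] /= := eqVneq z y; first by rewrite (negbTE yQ) andbF.
  have [yz /=|//] := boolP (z \in phi [set y]).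
  have -> : z \in Q by apply: (subsetP below); rewrite !inE zy.
  by apply: (subsetP _ z yz); rewrite closure1_sub.
have joinE : cjoin phi (Q :&: C1) (Q :&: C2) = phi Q.
  apply/eqP; apply: contraT => ne.
  have : cjoin phi (Q :&: C1) (Q :&: C2) \proper phi Q.
    rewrite properEneq ne; apply: closureUS; first exact: closed_closure.
      exact: subset_trans (subsetIl _ _) (sub_closure _).
    exact: subset_trans (subsetIl _ _) (sub_closure _).
  (* A proper join would lie in a lower cover [C3]. As [C3] differs from [C1] or from [C2], the
     trace of [Q] on that cover escapes [C3]. *)
  case/(lower_cover_above (closed_closure _)) => C3 cov3.
  have [c3 _ _] := cov3; rewrite closure_sub // subUset => /andP[s1 s2].
  have [e|n13] := eqVneq C1 C3.
    move: s2; apply: contraLR => _.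
    by apply: binary_closed_lower_cover => //; rewrite -e eq_sym.
  by move: s1; apply: contraLR => _; apply: binary_closed_lower_cover.
have := MSD (phi [set y]) (Q :&: C1) (Q :&: C2) (closed_closure _).
rewrite !qQ // !meetE // joinE => /(_ isT isT erefl) /setP/(_ y).
by rewrite !inE eqxx mem_closure1 (subsetP (proper_sub C1C)).
Qed.

Lemma E_generator_quasi_closed (Q : {set U}) :
  semidistributive phi -> bin Q = Q ->
  (forall B : {set U}, B \subset Q -> phi B \proper phi Q -> phi B \subset Q) ->
  ~~ closed Q ->
  exists x A, [/\ E_generator phi x A, A \subset Q & x \notin Q].
Proof.
move=> SD bQ qQ ncQ; have [JSD _] := SD.
have qI K : closed K -> K \proper phi Q -> closed (Q :&: K).
  move=> cK KC; rewrite /is_closed eqEsubset sub_closure andbT.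
  have sK : phi (Q :&: K) \subset K by rewrite closure_sub ?subsetIr.
  rewrite subsetI sK andbT; apply: qQ; first exact: subsetIl.
  exact: sub_proper_trans sK KC.
have [x0 x0C x0Q] : exists2 x0, x0 \in phi Q & x0 \notin Q.
  by apply/subsetPn; apply: contra ncQ => ?; rewrite /is_closed eqEsubset sub_closure andbT.
have x0S : phi [set x0] \subset phi Q by rewrite closure1_sub ?closed_closure.
(* By standardness, a point generating the same closed set as [Q] would belong to [Q]. *)
have x0P : phi [set x0] \proper phi Q.
  rewrite properEneq x0S andbT; apply: contra x0Q => /eqP e.
  by apply: standard_generator => //; rewrite e sub_closure.
have [C1 cov1 x0C1] := lower_cover_above (closed_closure _) x0P.
have [c1 C1C _] := cov1.
have QC1 : Q :&: C1 \proper C1.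
  rewrite properE subsetIr /= subsetI subxx andbT.
  apply: contra x0Q => /subsetP; apply.
  by rewrite closure1_sub in x0C1.
have [H covH QH] := lower_cover_above (qI _ c1 C1C) QC1.
have [cH HC1 _] := covH.
have [x + minx] := least_outside_lower_cover JSD c1 covH.
rewrite inE => /andP[xH xC1].
have xQ : x \notin Q.
  by apply: contra xH => xQ; apply: (subsetP QH); rewrite inE xQ.
have xC : x \in phi Q by apply: (subsetP (proper_sub C1C)).
have xnb : x \notin bin Q by rewrite bQ.
have [A dA] := D_generator_refine xC xnb; rewrite bQ => bAQ.
have AQ : A \subset Q by apply: subset_trans (sub_binary_part _) bAQ.
exists x, A; split=> //; apply/E_generatorP; split=> // B /D_generatorP[xB xbB _ _].
(* If [phi B] is strictly below [phi A], it lies in a lower cover [C2] of [phi Q]. A cover other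
   than [C1] would put [x] in [C1 :&: C2], hence in [Q]. So [B] lies in [C1] and, as it generates
   [x], has a point outside [H], which is above [x]. *)
apply: contra xbB => BA.
have BC : phi B \proper phi Q by apply: proper_sub_trans BA (closureS AQ).
have [C2 cov2 BC2] := lower_cover_above (closed_closure _) BC.
have [C12|C12] := eqVneq C1 C2; last first.
  case/negP: xQ; apply: (subsetP (quasi_closed_lower_coversI SD bQ qI cov1 cov2 C12)).
  by rewrite inE xC1 (subsetP BC2).
rewrite -C12 closure_sub // in BC2.
have /subsetPn[b bB bH] : ~~ (B \subset H).
  apply: contra xH => BH; apply: (subsetP _ _ xB); by rewrite closure_sub.
apply/mem_binary_part; exists b => //; apply: minx.
by rewrite inE bH (subsetP BC2).
Qed.

Lemma models_E_baseP (C : {set U}) :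
  reflect (bin C = C /\ forall x A, E_generator phi x A -> A \subset C -> x \in C)
          (models (E_base phi) C).
Proof.
apply: (iffP (modelsP _ _)) => [mC | [bC eC] i].
  split=> [|x A eA AC].
    apply/eqP; rewrite eqEsubset sub_binary_part andbT.
    apply/subsetP => x /mem_binary_part[a aC xa].
    have [->//|xna] := eqVneq x a.
    have /mC : ([set a], [set x]) \in E_base phi.
      apply/setUP; left; apply/imset2P.
      by exists a x; rewrite ?inE ?xna ?xa.
    by rewrite /= !sub1set; apply.
  have /mC : (A, [set x]) \in E_base phi.
    by apply/setUP; right; apply/imset2P; exists x A; rewrite ?inE.
  by rewrite /= sub1set; apply.
case/setUP => /imset2P.
  case=> a x _; rewrite !inE => /andP[_ xa] -> /=; rewrite !sub1set => aC.
  by rewrite -bC; apply/mem_binary_part; exists a.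
by case=> x A _; rewrite inE => eA -> /=; rewrite sub1set; apply: eC.
Qed.

Lemma models_E_base (C : {set U}) :
  semidistributive phi -> models (E_base phi) C = closed C.
Proof.
move=> SD; apply/models_E_baseP/idP => [|/eqP cC]; last first.
  split=> [|x A /E_generatorP[/D_generatorP[xA _ _ _] _] AC].
    apply/eqP; rewrite eqEsubset sub_binary_part andbT.
    by rewrite -{2}cC binary_part_sub_closure.
  by rewrite -cC; apply: subsetP xA; apply: closureS.
(* Strong induction on the size of [phi C]. It supplies quasi-closedness: for [B] in [C] with
   [phi B] smaller than [phi C], the trace [S] of [C] on [phi B] is again a model, so it is closed
   and equals [phi B]. *)
move: {-1}_.+1 (ltnSn #|phi C|) => n; elim: n C => // n IHn C leC [bC eC].
apply: contraT => ncC.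
have [B BC BP|x [A [eA AC]]] := E_generator_quasi_closed SD bC _ ncC; last first.
  by rewrite (eC x A).
pose S := C :&: phi B.
have BS : B \subset S by rewrite subsetI BC sub_closure.
have SB : phi S = phi B.
  apply/eqP; rewrite eqEsubset closure_sub ?closed_closure //.
  by rewrite subsetIr closureS.
have : closed S.
  apply: IHn; first by rewrite SB; apply: leq_trans (proper_card BP) leC.
  split=> [|x A eA].
    apply/eqP; rewrite eqEsubset sub_binary_part andbT subsetI.
    rewrite -{1}bC binary_partS ?subsetIl //=.
    by rewrite -SB binary_part_sub_closure.
  rewrite subsetI => /andP[AC AB]; rewrite inE (eC x A) //=.
  case/E_generatorP: eA => /D_generatorP[xA _ _ _] _.
  by apply: (subsetP _ _ xA); rewrite closure_sub ?closed_closure.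
by rewrite /is_closed SB => /eqP ->; apply: subsetIl.
Qed.

(** * Recovering a generator from its closure *)

Lemma closure_binary_partI (X Y : {set U}) :
  join_semidistributive phi -> phi X = phi Y -> phi (bin X :&: bin Y) = phi X.
Proof.
move=> JSD XY; apply/eqP; apply: contraT => ne.
(* Otherwise the intersection lies in a lower cover [K]. Neither [X] nor [Y] lies in [K], so
   principal closures taken from each meet outside [K], yet inside both binary parts. *)
have : phi (bin X :&: bin Y) \proper phi X.
  by rewrite properEneq ne -(closure_binary_part X) closureS ?subsetIl.
case/(lower_cover_above (closed_closure _)) => K covK.
have [cK KC _] := covK; rewrite closure_sub // => sK.
have out Z : phi Z = phi X -> exists2 z, z \in Z & z \notin K.
  move=> ZX; apply/subsetPn; apply/negP => ZK.
  by move: KC; rewrite properE -ZX closure_sub // ZK andbF.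
have [x xX xK] := out X erefl; have [y yY yK] := out Y (esym XY).
have : ~~ (phi [set x] :&: phi [set y] \subset K).
  apply: (join_semidistributive_lower_cover JSD (closed_closure X) covK);
    rewrite ?closed_closure ?closure1_sub ?closed_closure //.
    exact: (subsetP (sub_closure X)).
  by rewrite XY; apply: (subsetP (sub_closure Y)).
case/negP; apply: subset_trans sK; apply: setISS; exact: bigcup_sup.
Qed.

(** A D-generator consists of the maximal points of its binary part: a point below another one could
    be dropped, and standardness makes the order on points antisymmetric. *)
Lemma D_generator_binary_part_inj x x' (A A' : {set U}) :
  D_generator phi x A -> D_generator phi x' A' -> bin A = bin A' -> A = A'.
Proof.
suff half y (B B' : {set U}) :
    D_generator phi y B -> bin B = bin B' -> B \subset B'.
  by move=> dA dA' e; apply/eqP; rewrite eqEsubset (half x) // (half x').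
move=> /D_generatorP[yB _ _ mB] BB'; apply/subsetP => b bB.
have /mem_binary_part[b' b'B' bb'] : b \in bin B'.
  by rewrite -BB' (subsetP (sub_binary_part B)).
have /mem_binary_part[c cB b'c] : b' \in bin B.
  by rewrite BB' (subsetP (sub_binary_part B')).
have bc : b \in phi [set c].
  by apply: (subsetP _ _ bb'); rewrite closure1_sub ?closed_closure.
have [cb|cb] := eqVneq c b.
  by rewrite (closure1_antisym bb') // -cb.
have /mB/negP[] : B :\ b \proper B by apply: properD1.
apply: (subsetP _ _ yB); rewrite closure_sub ?closed_closure //.
apply/subsetP => z zB; have [->|zb] := eqVneq z b.
  by apply: (subsetP _ _ bc); apply: closureS; rewrite sub1set !inE cb.
by apply: (subsetP (sub_closure _)); rewrite !inE zb.
Qed.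

(** The intersection of the two binary parts still generates the common closure, so minimality of
    each binary part makes both equal to it. *)
Lemma D_generator_closure_inj x x' (A A' : {set U}) :
  join_semidistributive phi ->
  D_generator phi x A -> D_generator phi x' A' -> phi A = phi A' -> A = A'.
Proof.
move=> JSD dA dA' AA'; apply: (D_generator_binary_part_inj dA dA').
suff half y (B B' : {set U}) :
    D_generator phi y B -> phi B = phi B' -> bin B \subset bin B'.
  by apply/eqP; rewrite eqEsubset (half x) // (half x').
move=> /D_generatorP[yB _ hB _] BB'.
have bI : bin (bin B :&: bin B') \subset bin B.
  by rewrite -{2}(binary_partK B) binary_partS ?subsetIl.
have /eqP <- : bin (bin B :&: bin B') == bin B.
  apply: contraT => ne; have /hB : bin (bin B :&: bin B') \proper bin B.
    by rewrite properEneq ne.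
  by rewrite closure_binary_partI // yB.
by rewrite -{2}(binary_partK B') binary_partS ?subsetIr.
Qed.

(** This separates the premises of the binary implications from the other ones. If the closures
    agreed, standardness would put [a] in [A], and [x] would be in the binary part. *)
Lemma D_generator_closure1 x (A : {set U}) a :
  D_generator phi x A -> phi A != phi [set a].
Proof.
case/D_generatorP=> xA xbA _ _; apply: contra xbA => /eqP e.
apply/mem_binary_part; exists a; last by rewrite -e.
by apply: standard_generator; rewrite -?e ?sub_closure // e mem_closure1.
Qed.

(** * Counting premises by their closures *)

Lemma E_base_premiseP (A : {set U}) :
  A \in [set i.1 | i in E_base phi] ->
  (exists a x, [/\ A = [set a], x != a & x \in phi [set a]]) \/
  exists x, E_generator phi x A.
Proof.
case/imsetP => i /setUP[] /imset2P.
  case=> a x _; rewrite !inE => /andP[xa ax] -> ->; left.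
  by exists a, x.
by case=> x B _; rewrite inE => eB -> ->; right; exists x.
Qed.

Lemma closure_inj_premises :
  join_semidistributive phi ->
  {in [set i.1 | i in E_base phi] &, injective phi}.
Proof.
move=> JSD A B /E_base_premiseP[[a [x [-> _ _]]]|[x /E_generatorP[dA _]]];
  move=> /E_base_premiseP[[b [y [-> _ _]]]|[y /E_generatorP[dB _]]] e.
- congr [set _]; apply: closure1_antisym; first by rewrite -e mem_closure1.
  by rewrite e mem_closure1.
- by have := D_generator_closure1 a dB; rewrite e eqxx.
- by have := D_generator_closure1 b dA; rewrite e eqxx.
- exact: D_generator_closure_inj dA dB e.
Qed.

(** Some implication of [Sigma] fails in [Q]. Its premise lies in [Q] but the closure of that
    premise does not, which leaves [C] as the only possible closure. *)
Lemma quasi_closed_valid (Sigma : {set implication U}) (Q C : {set U}) :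
  valid phi Sigma -> ~~ closed Q ->
  (forall B : {set U}, B \subset Q -> phi B != C -> phi B \subset Q) ->
  exists2 i, i \in Sigma & phi i.1 = C.
Proof.
move=> vS ncQ qQ.
have /forall_inPn[i iS] : ~~ models Sigma Q.
  apply: contra ncQ => mQ; rewrite /is_closed eqEsubset sub_closure andbT.
  by rewrite -vS models_sub_induced_closure.
rewrite negb_imply => /andP[i1 i2]; exists i => //.
apply/eqP; apply: contraT => /(qQ _ i1) sQ; case/negP: i2.
exact: subset_trans (valid_conclusion vS iS) sQ.
Qed.

Lemma E_generator_premise_valid (Sigma : {set implication U}) x (A : {set U}) :
  valid phi Sigma -> E_generator phi x A ->
  exists2 i, i \in Sigma & phi i.1 = phi A.
Proof.
move=> vS /E_generatorP[/D_generatorP[xA xbA _ _] eA].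
pose Q := [set y in phi A | x \notin phi [set y]].
have AQ : A \subset Q.
  apply/subsetP => a aA; rewrite inE (subsetP (sub_closure A)) //=.
  by apply: contra xbA => xa; apply/mem_binary_part; exists a.
apply: (quasi_closed_valid (Q := Q)) => // [|B BQ BA].
  apply/negP => /eqP cQ; have := subsetP (closureS AQ) x xA.
  by rewrite cQ inE mem_closure1 andbF.
have BsA : phi B \subset phi A.
  rewrite closure_sub ?closed_closure //; apply: subset_trans BQ _.
  by apply/subsetP => z; rewrite inE => /andP[].
have BpA : phi B \proper phi A by rewrite properEneq BA.
apply/subsetP => y yB; rewrite inE (subsetP BsA) //=; apply/negP => xy.
have xB : x \in phi B.
  by apply: (subsetP _ _ xy); rewrite closure1_sub ?closed_closure.
(* Either a point of [B] is above [x], which [Q] excludes, or [B] refines to a D-generator of [x]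
   with closure strictly below [phi A], against the choice of [A]. *)
have [/mem_binary_part[b bB xb]|xbB] := boolP (x \in bin B).
  by have := subsetP BQ b bB; rewrite inE xb andbF.
have [D dD bD] := D_generator_refine xB xbB.
case/negP: (eA D dD); apply: sub_proper_trans BpA.
by rewrite -(closure_binary_part D) -(closure_binary_part B) closureS.
Qed.

Lemma E_base_premise_valid (Sigma : {set implication U}) (A : {set U}) :
  valid phi Sigma -> A \in [set i.1 | i in E_base phi] ->
  exists2 i, i \in Sigma & phi i.1 = phi A.
Proof.
move=> vS /E_base_premiseP[[a [x [-> xa ax]]]|[x eA]]; last first.
  exact: E_generator_premise_valid eA.
(* The only other subset of this singleton is empty, and the empty set is closed by standardness. *)
apply: (quasi_closed_valid (Q := [set a])) => // [|B].
  by apply/negP => /eqP ca; move: ax; rewrite ca inE (negbTE xa).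
rewrite subset1 => /orP[/eqP->|/eqP->]; first by rewrite eqxx.
by rewrite closure0 sub0set.
Qed.

End ClosureSpace.

Theorem theorem1 (U : finType) (phi : {set U} -> {set U})
  (phi_closure : closure_operator phi)
  (phi_standard : standard phi)
  (phi_semidistributive : semidistributive phi) :
  valid phi (aggregate (E_base phi)) /\
  (forall Sigma : {set implication U},
     valid phi Sigma -> #|aggregate (E_base phi)| <= #|Sigma|).
Proof.
split=> [|Sigma vS].
  by apply: valid_models => // C; rewrite models_aggregate models_E_base.
have [JSD _] := phi_semidistributive.
(* Aggregation leaves at most one implication per premise, and premises are as many as their
   closures, each of which is the closure of a premise of [Sigma]. *)
apply: leq_trans (leq_imset_card _ _) _.
rewrite -(card_in_imset (closure_inj_premises phi_closure phi_standard JSD)).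
apply: leq_trans (leq_imset_card (fun i : implication U => phi i.1) Sigma).
apply/subset_leq_card/subsetP => _ /imsetP[A Apre ->].
have [i iS <-] := E_base_premise_valid phi_closure phi_standard vS Apre.
by apply/imsetP; exists i.
Qed.
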